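(* (a) Suppose $a'>a\ge0$, $b>c>0$ and $\delta>0$. Then the function \[ x\mapsto {}_2F_1(a+\delta,b;c;x)\,{}_2F_1(a',b;c;x)-{}_2F_1(a'+\delta,b;c;x)\,{}_2F_1(a,b;c;x) \] has positive power series coefficients, starting with the coefficient at $x^2$. (b) Let $\delta>0$. The function $a\mapsto{}_2F_1(a,b;c;x)$ is log-concave, i.e. ${}_2F_1(a+\delta,b;c;x)^2\ge {}_2F_1(a,b;c;x)\,{}_2F_1(a+2\delta,b;c;x)$, on $[0,\infty)$ when $0<x<1$, $b>c>0$, and when $x<0$, $c>0>b$; and on $(-\infty,c]$ when $0<x<1$, $c>0>b$, and when $x<0$, $b>c>0$. (c) Let $\delta>0$. For $0<x<1$: \[ \frac{\Gamma(a+\delta)\Gamma(a')}{\Gamma(a)\Gamma(a'+\delta)}<\frac{{}_2F_1(a'+\delta,b;c;x)\,{}_2F_1(a,b;c;x)}{{}_2F_1(a+\delta,b;c;x)\,{}_2F_1(a',b;c;x)}<1 \qquad (\ast) \] holds if $b>c>0$, $a'>a>0$, and \[ \frac{\Gamma(c-a-\delta)\Gamma(c-a')}{\Gamma(c-a)\Gamma(c-a'-\delta)}<\frac{{}_2F_1(a'+\delta,b;c;x)\,{}_2F_1(a,b;c;x)}{{}_2F_1(a+\delta,b;c;x)\,{}_2F_1(a',b;c;x)}<1 \qquad (\ast\ast) \] holds if $c>0>b$, $c-\delta>a'>a$. Further, for $x<0$, $(\ast)$ holds if $c>0>b$, $a'>a>0$, and $(\ast\ast)$ holds if $b>c>0$,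 $c-\delta>a'>a$.
   Context: $(a)_k=a(a+1)\cdots(a+k-1)$ is the Pochhammer symbol; the Gauss hypergeometric function is ${}_2F_1(a,b;c;x)=\sum_{k\ge0}\frac{(a)_k(b)_k}{(c)_k k!}x^k$ (for $x<0$ understood via analytic continuation, e.g. Pfaff's transformation). $\Gamma$ is Euler's gamma function. *)

(* Defs.v *)
From Stdlib Require Import Reals.
From Coquelicot Require Import Coquelicot.
Open Scope R_scope.

Fixpoint poch (a : R) (k : nat) : R :=
  match k with
  | O => 1
  | S k' => poch a k' * (a + INR k')
  end.

Definition hgcoef (a b c : R) (k : nat) : R :=
  poch a k * poch b k / (poch c k * INR (Factorial.fact k)).

Definition hgseries (a b c x : R) : R :=
  Series (fun k => hgcoef a b c k * x ^ k).

(* 2F1(a,b;c;x): the power series for x >= 0 (used for 0 <= x < 1), and for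
   x < 0 the analytic continuation given by Pfaff's transformation
   2F1(a,b;c;x) = (1-x)^(-b) 2F1(c-a,b;c;x/(x-1)),  with x/(x-1) in (0,1). *)
Definition F21 (a b c x : R) : R :=
  if Rlt_dec x 0 then Rpower (1 - x) (- b) * hgseries (c - a) b c (x / (x - 1))
  else hgseries a b c x.

Definition Gamma (s : R) : R :=
  RInt_gen (fun t => Rpower t (s - 1) * exp (- t)) (at_right 0) (Rbar_locally p_infty).

Definition diff_coef (a a' b c d : R) (k : nat) : R :=
  sum_f_R0 (fun j => hgcoef (a + d) b c j * hgcoef a' b c (k - j)
                   - hgcoef (a' + d) b c j * hgcoef a b c (k - j)) k.

Definition ratio (a a' b c d x : R) : R :=
  F21 (a' + d) b c x * F21 a b c x / (F21 (a + d) b c x * F21 a' b c x).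

(* Main.v *)
Require Import Defs.
From Stdlib Require Import Reals Factorial Lra Lia.
From Coquelicot Require Import Coquelicot.
Open Scope R_scope.

(* Write [P = {a+d, a'}] and [Q = {a, a'+d}]: two pairs of parameters with the same sum, [Q]
   being the wider one. In the coefficient of [x^k] of [F(a+d) F(a') - F(a'+d) F(a)], pair the
   indices [j] and [k-j]: the coefficient becomes half the sum of [G_j D_j], where
   [G_j = g_j g_(k-j)] with [g_j = (b)_j / (c)_j] log-concave for [b > c], hence [G] is unimodal,
   while [D] sums to [0] by Vandermonde and changes sign exactly once, from negative to
   nonnegative, between [j = 0] and [j = k/2]. This gives (a), hence the upper bounds in (c) and
   the log-concavity (b). For the lower bound, [x |-> (x)_m] is convex, and the Gamma quotient
   bounds [(a)_j (a'+d)_j / ((a+d)_j (a')_j)] from below because Gamma is log-convex.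
   Euler's transformation turns the cases [c > 0 > b] into [b > c > 0]. *)

(** * Pochhammer symbols *)

Lemma poch_nonneg (x : R) (k : nat) : 0 <= x -> 0 <= poch x k.
Proof.
  intros Hx; induction k as [|k IH]; simpl; [lra|].
  apply Rmult_le_pos; [exact IH|]. pose proof (pos_INR k); lra.
Qed.

Lemma poch_pos (x : R) (k : nat) : 0 < x -> 0 < poch x k.
Proof.
  intros Hx; induction k as [|k IH]; simpl; [lra|].
  apply Rmult_lt_0_compat; [exact IH|]. pose proof (pos_INR k); lra.
Qed.

Lemma poch_add (x : R) (j m : nat) : poch x (j + m) = poch x j * poch (x + INR j) m.
Proof.
  induction m as [|m IH].
  - rewrite Nat.add_0_r; simpl; ring.
  - rewrite Nat.add_succ_r; simpl; rewrite IH, plus_INR; ring.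
Qed.

Lemma poch_S_l (x : R) (m : nat) : poch x (S m) = x * poch (x + 1) m.
Proof. replace (S m) with (1 + m)%nat by lia. rewrite poch_add; simpl; ring. Qed.

Lemma poch_le (x y : R) (m : nat) : 0 <= x <= y -> poch x m <= poch y m.
Proof.
  intros Hxy; induction m as [|m IH]; simpl; [lra|].
  pose proof (pos_INR m). apply Rmult_le_compat; try lra.
  apply poch_nonneg; lra.
Qed.

Lemma poch_lt (x y : R) (m : nat) : 0 <= x < y -> poch x (S m) < poch y (S m).
Proof.
  intros Hxy. rewrite !poch_S_l.
  assert (poch (x + 1) m <= poch (y + 1) m) by (apply poch_le; lra).
  assert (0 < poch (x + 1) m) by (apply poch_pos; lra).
  nra.
Qed.

(** Discrete convexity of [z |-> poch z k]. In the induction step the excess of the right side is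
    multiplied by [x + INR k] and gains [e ((y+e)_k - (x+e)_k) + (y-x) ((y+e)_k - (y)_k)],
    nonnegative by monotonicity. *)
Lemma poch_convex_pair (x y e : R) (k : nat) : 0 <= x < y -> 0 < e ->
  poch (x + e) k + poch y k <= poch x k + poch (y + e) k.
Proof.
  intros Hxy He; induction k as [|k IH]; simpl; [lra|].
  assert (poch (x + e) k <= poch (y + e) k) by (apply poch_le; lra).
  assert (poch y k <= poch (y + e) k) by (apply poch_le; lra).
  pose proof (pos_INR k). nra.
Qed.

(** Strictness begins at degree 2, since degrees 0 and 1 are affine in the parameter. *)
Lemma poch_strict_convex_pair (x y e : R) (k : nat) : 0 <= x < y -> 0 < e ->
  poch (x + e) (S (S k)) + poch y (S (S k)) < poch x (S (S k)) + poch (y + e) (S (S k)).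
Proof.
  intros Hxy He.
  assert (H1 : poch (x + e) (S k) + poch y (S k) <= poch x (S k) + poch (y + e) (S k))
    by (apply poch_convex_pair; lra).
  assert (H2 : poch (x + e) (S k) < poch (y + e) (S k)) by (apply poch_lt; lra).
  assert (H3 : poch y (S k) <= poch (y + e) (S k)) by (apply poch_le; lra).
  assert (H4 : forall z, poch z (S (S k)) = poch z (S k) * (z + INR (S k))) by reflexivity.
  rewrite !H4. pose proof (pos_INR (S k)). nra.
Qed.

Lemma poch_cross_le (P Q r t : R) (n : nat) : 0 <= r <= P -> 0 <= Q <= t ->
  poch Q n * poch r n <= poch P n * poch t n.
Proof.
  intros H1 H2. rewrite (Rmult_comm (poch P n)).
  apply Rmult_le_compat; try (apply poch_nonneg; lra); apply poch_le; lra.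
Qed.

(** Symmetrised under [j <-> k - j], so that only indices with [2 * j <= k] need to be
    controlled. *)
Definition phi (k : nat) (p q : R) (j : nat) : R :=
  poch p j * poch q (k - j) + poch q j * poch p (k - j).

Lemma phi_rev (k : nat) (p q : R) (j : nat) : (j <= k)%nat -> phi k p q (k - j) = phi k p q j.
Proof. intros Hj; unfold phi. replace (k - (k - j))%nat with j by lia. ring. Qed.

Lemma phi_comm (k : nat) (p q : R) (j : nat) : phi k p q j = phi k q p j.
Proof. unfold phi; ring. Qed.

(** Pulling out the first [j] factors of each symbol leaves a sum of two symbols of the same length
    [m], to which convexity and [poch_spread] apply. *)
Lemma phi_factor (j m : nat) (p q : R) :
  phi (j + m + j) p q j
  = poch p j * poch q j * (poch (p + INR j) m + poch (q + INR j) m).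
Proof.
  unfold phi. replace (j + m + j - j)%nat with (j + m)%nat by lia.
  rewrite !poch_add; ring.
Qed.

(* The quotient [((P)_m + (Q)_m) / (P Q ((P+1)_(m-2) + (Q+1)_(m-2)))] grows when
   [P], [Q] are spread apart at constant sum: it is
   [(hi + lo)/2 + (w - 1/2) (hi - lo)] with [hi = (Q+m-1)/P], [lo = (P+m-1)/Q] and
   weight [w = (Q+1)_(m-2) / ((P+1)_(m-2) + (Q+1)_(m-2)) >= 1/2], all increasing. *)
Lemma poch_spread (P Q r t : R) (m : nat) :
  0 <= r <= P -> P <= Q -> Q <= t -> P + Q = r + t ->
  (poch P (S (S m)) + poch Q (S (S m))) * (r * t * (poch (r + 1) m + poch (t + 1) m))
  <= (poch r (S (S m)) + poch t (S (S m))) * (P * Q * (poch (P + 1) m + poch (Q + 1) m)).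
Proof.
  intros H1 H2 H3 H4.
  assert (E : forall z, poch z (S (S m)) = z * poch (z + 1) m * (z + INR (S m))).
  { intros z. change (poch z (S (S m))) with (poch z (S m) * (z + INR (S m))).
    rewrite poch_S_l; ring. }
  rewrite !E.
  assert (HA : 0 < poch (P + 1) m) by (apply poch_pos; lra).
  assert (HB : poch (P + 1) m <= poch (Q + 1) m) by (apply poch_le; lra).
  assert (HA' : 0 < poch (r + 1) m) by (apply poch_pos; lra).
  assert (HB' : poch (r + 1) m <= poch (t + 1) m) by (apply poch_le; lra).
  assert (HC : poch (Q + 1) m * poch (r + 1) m <= poch (P + 1) m * poch (t + 1) m)
    by (apply poch_cross_le; lra).
  assert (Hn : 0 <= INR (S m)) by apply pos_INR.
  revert HA HB HA' HB' HC Hn.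
  generalize (poch (P + 1) m) (poch (Q + 1) m) (poch (r + 1) m) (poch (t + 1) m) (INR (S m)).
  intros A B A' B' n HA HB HA' HB' HC Hn.
  assert (Hpq : r * t <= P * Q) by (assert (t = P + Q - r) by lra; subst t; nra).
  assert (Hrt : 0 <= r * t) by (apply Rmult_le_pos; lra).
  assert (Hsq : P * P + Q * Q <= r * r + t * t).
  { assert ((P + Q) * (P + Q) = (r + t) * (r + t)) by (rewrite H4; ring). nra. }
  set (s := P + Q).
  (* Split [P A (P+n) + Q B (Q+n)] into [(A+B)(P^2+Q^2+n s)/2] and [(B-A)(Q-P)(s+n)/2], and likewise
     for [r], [t]. Twice the gap to be shown nonnegative is then the sum of the quantities in [K1]
     and [K3]. *)
  assert (K1 : 0 <= (A + B) * (A' + B')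
    * (P * Q * (r * r + t * t + n * s) - r * t * (P * P + Q * Q + n * s))).
  { apply Rmult_le_pos; [apply Rmult_le_pos; lra|].
    assert (r * t * (P * P + Q * Q + n * s) <= P * Q * (r * r + t * t + n * s)); [|lra].
    assert (0 <= n * s) by (apply Rmult_le_pos; unfold s; lra).
    apply Rmult_le_compat; nra. }
  assert (K2 : r * t * ((A' + B') * (B - A)) * (Q - P) <= P * Q * ((A + B) * (B' - A')) * (t - r)).
  { assert (0 <= (A' + B') * (B - A)) by (apply Rmult_le_pos; lra).
    (* The two sides differ by [2 (A B' - A' B)], nonnegative by [HC]. *)
    assert ((A' + B') * (B - A) <= (A + B) * (B' - A')) by nra.
    apply Rmult_le_compat; [apply Rmult_le_pos; lra|lra| |lra].
    apply Rmult_le_compat; lra. }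
  assert (K3 : 0 <= (P * Q * ((A + B) * (B' - A')) * (t - r)
               - r * t * ((A' + B') * (B - A)) * (Q - P)) * (s + n)).
  { apply Rmult_le_pos; [lra|unfold s; lra]. }
  assert (Ht : t = s - r) by (unfold s; lra).
  assert (HQ : Q = s - P) by (unfold s; lra).
  clearbody s. subst t Q. clear - K1 K3. nra.
Qed.

(** The growth factor from [j] to [S j] is [P Q ((P+1)_m + (Q+1)_m) / ((P)_(m+2) + (Q)_(m+2))] with
    [P = p + j], [Q = q + j]. By [poch_spread] it is at least the one of the wider pair, so the
    inequality persists once it holds. The proof cross-multiplies, using [K] and then [H]. *)
Lemma phi_crossing (k j : nat) (p q r t : R) : (2 * j + 2 <= k)%nat ->
  0 <= r < p -> p <= q -> q <= t -> p + q = r + t ->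
  phi k r t j <= phi k p q j -> phi k r t (S j) <= phi k p q (S j).
Proof.
  intros Hk H1 H2 H3 H4 H.
  destruct (Nat.le_exists_sub (2 * j + 2) k Hk) as [m [Em _]].
  replace k with (j + S (S m) + j)%nat in H by lia.
  replace k with (S j + m + S j)%nat by lia.
  rewrite !phi_factor in H. rewrite !phi_factor.
  pose proof (pos_INR j) as Hj.
  assert (K := poch_spread (p + INR j) (q + INR j) (r + INR j) (t + INR j) m
     ltac:(lra) ltac:(lra) ltac:(lra) ltac:(lra)).
  replace (INR (S j)) with (INR j + 1) by (rewrite S_INR; ring).
  rewrite <- !Rplus_assoc. simpl (poch _ (S j)).
  assert (HS : 0 < poch (p + INR j) (S (S m)) + poch (q + INR j) (S (S m))).
  { apply Rplus_lt_0_compat; apply poch_pos; lra. }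
  assert (HS' : 0 < (p + INR j) * (q + INR j) *
     (poch (p + INR j + 1) m + poch (q + INR j + 1) m)).
  { apply Rmult_lt_0_compat; [apply Rmult_lt_0_compat; lra|].
    apply Rplus_lt_0_compat; apply poch_pos; lra. }
  assert (Hr : 0 <= poch r j * poch t j) by (apply Rmult_le_pos; apply poch_nonneg; lra).
  revert H K HS HS' Hr.
  generalize (poch (p + INR j) (S (S m)) + poch (q + INR j) (S (S m)))
    (poch (r + INR j) (S (S m)) + poch (t + INR j) (S (S m)))
    (poch (p + INR j + 1) m + poch (q + INR j + 1) m)
    (poch (r + INR j + 1) m + poch (t + INR j + 1) m).
  intros S1 S2 S3 S4 H K HS HS' Hr.
  apply Rmult_le_reg_r with S1; [exact HS|].
  apply Rle_trans with (poch r j * poch t j * S2 * ((p + INR j) * (q + INR j) * S3)).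
  - apply Rle_trans with (poch r j * poch t j * (S1 * ((r + INR j) * (t + INR j) * S4))).
    + right; ring.
    + rewrite (Rmult_assoc (poch r j * poch t j)). apply Rmult_le_compat_l; assumption.
  - apply Rle_trans with (poch p j * poch q j * S1 * ((p + INR j) * (q + INR j) * S3)).
    + apply Rmult_le_compat_r; lra.
    + right; ring.
Qed.

(** * Finite sums, Vandermonde convolution and sign changes *)

Lemma sum_f_R0_nonneg (f : nat -> R) (n : nat) :
  (forall j, (j <= n)%nat -> 0 <= f j) -> 0 <= sum_f_R0 f n.
Proof.
  intros H; induction n as [|n IH]; simpl; [apply H; lia|].
  apply Rplus_le_le_0_compat; [apply IH; intros; apply H; lia|apply H; lia].
Qed.

Lemma sum_f_R0_pos_first (f : nat -> R) (n : nat) :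
  (forall j, (j <= n)%nat -> 0 <= f j) -> 0 < f O -> 0 < sum_f_R0 f n.
Proof.
  intros H H0; induction n as [|n IH]; simpl; [exact H0|].
  apply Rplus_lt_le_0_compat; [apply IH; intros; apply H; lia|apply H; lia].
Qed.

Lemma sum_f_R0_lin (u v : R) (f g : nat -> R) (n : nat) :
  sum_f_R0 (fun j => u * f j + v * g j) n = u * sum_f_R0 f n + v * sum_f_R0 g n.
Proof. induction n as [|n IH]; simpl; [|rewrite IH]; ring. Qed.

(** Chu-Vandermonde. The induction multiplies the sum by [k + 1 = j + (k + 1 - j)]; after the
    recurrence of [e] is applied to each half, the factors [p + j] and [q + k - j] add up to
    [p + q + k]. *)
Lemma poch_fact_vandermonde (p q : R) (k : nat) :
  sum_f_R0 (fun j => poch p j / INR (fact j) * (poch q (k - j) / INR (fact (k - j)))) k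
  = poch (p + q) k / INR (fact k).
Proof.
  set (e := fun p j => poch p j / INR (fact j)).
  change (sum_f_R0 (fun j => e p j * e q (k - j)%nat) k = e (p + q) k).
  assert (He : forall z j, INR (S j) * e z (S j) = (z + INR j) * e z j).
  { intros z j. unfold e. simpl poch. rewrite fact_simpl, mult_INR. field.
    split; [apply INR_fact_neq_0|apply not_0_INR; lia]. }
  induction k as [|k IH].
  - unfold e; simpl; field.
  - apply Rmult_eq_reg_l with (INR (S k)); [|apply not_0_INR; lia].
    rewrite He, <- IH.
    set (T := fun j => e p j * e q (S k - j)%nat).
    transitivity (sum_f_R0 (fun j => INR j * T j) (S k)
       + sum_f_R0 (fun j => INR (S k - j) * T j) (S k)).
    { rewrite <- plus_sum. rewrite scal_sum. apply sum_eq. intros j Hj.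
      rewrite minus_INR by lia. unfold T. ring. }
    (* The term [j = 0] of the first half and the term [j = S k] of the second vanish, so both
       halves become sums over [0..k]. *)
    rewrite (decomp_sum (fun j => INR j * T j)) by lia.
    rewrite (tech5 (fun j => INR (S k - j) * T j)).
    simpl pred. rewrite Nat.sub_diag. simpl (INR 0).
    rewrite !Rmult_0_l, Rplus_0_l, Rplus_0_r.
    rewrite <- plus_sum, scal_sum. apply sum_eq. intros j Hj. unfold T.
    replace (S k - S j)%nat with (k - j)%nat by lia.
    replace (S k - j)%nat with (S (k - j)) by lia.
    replace (INR (S j) * (e p (S j) * e q (k - j)%nat))
      with ((p + INR j) * e p j * e q (k - j)%nat) by (rewrite <- He; ring).
    replace (INR (S (k - j)) * (e p j * e q (S (k - j))))
      with ((q + INR (k - j)) * e q (k - j)%nat * e p j) by (rewrite <- He; ring).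
    rewrite minus_INR by lia. ring.
Qed.

(** The value of [P] at the pivot is left open, since the pivot's own term will vanish. The bound
    [1 <= i] keeps the pivot away from [0], where strictness is obtained. *)
Lemma sign_change_pivot (P : nat -> Prop) (n : nat) :
  (forall j, P j \/ ~ P j) -> (forall j, (j < n)%nat -> P j -> P (S j)) -> ~ P O -> (1 <= n)%nat ->
  exists i, (1 <= i <= n)%nat /\ (forall j, (j < i)%nat -> ~ P j)
            /\ (forall j, (i < j <= n)%nat -> P j).
Proof.
  intros Hdec Hup H0. induction n as [|n IH]; intros Hn; [lia|].
  destruct (Nat.eq_dec n 0) as [->|Hn0].
  - exists 1%nat. split; [lia|split; [|lia]]. intros j Hj. replace j with O by lia. exact H0.
  - destruct IH as [i [Hi [Hlo Hhi]]]; [intros j Hj; apply Hup; lia|lia|].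
    destruct (Hdec n) as [Hp|Hp].
    + exists i. split; [lia|split; [exact Hlo|]]. intros j Hj.
      destruct (Nat.eq_dec j (S n)) as [->|]; [apply Hup; [lia|exact Hp]|apply Hhi; lia].
    (* [P n] fails, hence by upward propagation [P] fails at every [j <= n], and [S n] can be the
       pivot. *)
    + exists (S n). split; [lia|split; [|lia]]. intros j Hj.
      destruct (Nat.eq_dec j n) as [->|Hjn]; [exact Hp|].
      destruct (Nat.le_gt_cases j i) as [Hji|Hji].
      * destruct (Nat.eq_dec j i) as [->|]; [|apply Hlo; lia].
        intros HPi. apply Hp. assert (Hq : forall l, (i + l <= n)%nat -> P (i + l)%nat).
        { induction l as [|l IHl]; intros Hl; [rewrite Nat.add_0_r; exact HPi|].
          rewrite Nat.add_succ_r. apply Hup; [lia|apply IHl; lia]. }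
        replace n with (i + (n - i))%nat by lia. apply Hq; lia.
      * exfalso. apply Hp, Hhi; lia.
Qed.

(* Subtracting the pivot value [G i] is free because [D] sums to [0], and makes every
   term [(G j - G i) * D j] nonnegative. *)
Lemma sum_unimodal_pos (G D : nat -> R) (k : nat) : (2 <= k)%nat ->
  (forall j, (j <= k)%nat -> G (k - j)%nat = G j) ->
  (forall j, (j <= k)%nat -> D (k - j)%nat = D j) ->
  (forall j, (2 * j + 2 <= k)%nat -> G j < G (S j)) ->
  (forall j, (2 * j + 2 <= k)%nat -> 0 <= D j -> 0 <= D (S j)) ->
  D O < 0 -> sum_f_R0 D k = 0 ->
  0 < sum_f_R0 (fun j => G j * D j) k.
Proof.
  intros Hk Gs Ds Gi Di D0 DS.
  assert (Hh : (2 * (k / 2) <= k < 2 * (k / 2) + 2)%nat).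
  { pose proof (Nat.div_mod_eq k 2). pose proof (Nat.mod_upper_bound k 2). lia. }
  destruct (sign_change_pivot (fun j => 0 <= D j) (k / 2)) as [i [Hi [Hlo Hhi]]].
  - intros j. destruct (Rle_dec 0 (D j)); [left|right]; assumption.
  - intros j Hj. apply Di. lia.
  - lra.
  - lia.
  - assert (Gm : forall j l, (2 * (j + S l) <= k)%nat -> G j < G (j + S l)%nat).
    { intros j l; induction l as [|l IH]; intros Hl.
      - rewrite Nat.add_1_r. apply Gi; lia.
      - apply Rlt_trans with (G (j + S l)%nat); [apply IH; lia|].
        rewrite (Nat.add_succ_r j (S l)). apply Gi; lia. }
    assert (Hhalf : forall j, (2 * j <= k)%nat -> 0 <= (G j - G i) * D j).
    { intros j Hj. destruct (Nat.lt_trichotomy j i) as [Hji|[-> |Hji]].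
      - pose proof (Gm j (i - j - 1)%nat) as HG.
        replace (j + S (i - j - 1))%nat with i in HG by lia.
        specialize (HG ltac:(lia)). pose proof (Hlo j Hji). nra.
      - rewrite Rminus_diag. lra.
      - pose proof (Gm i (j - i - 1)%nat) as HG.
        replace (i + S (j - i - 1))%nat with j in HG by lia.
        specialize (HG ltac:(lia)). pose proof (Hhi j ltac:(lia)). nra. }
    replace (sum_f_R0 (fun j => G j * D j) k)
      with (sum_f_R0 (fun j => (G j - G i) * D j) k).
    + apply sum_f_R0_pos_first.
      * intros j Hj. destruct (Nat.le_gt_cases (2 * j) k) as [H2|H2]; [apply Hhalf, H2|].
        (* Indices beyond the middle are reflected to [k - j]. *)
        rewrite <- (Gs j Hj), <- (Ds j Hj). apply Hhalf; lia.
      (* Strictness comes from [j = 0], where [G 0 < G i] and [D 0 < 0]. *)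
      * pose proof (Gm O (i - 1)%nat ltac:(lia)) as HG.
        replace (0 + S (i - 1))%nat with i in HG by lia. nra.
    + rewrite (sum_eq _ (fun j => 1 * (G j * D j) + (- G i) * D j)).
      * rewrite sum_f_R0_lin, DS. ring.
      * intros; ring.
Qed.

(** * Products of hypergeometric coefficients *)

Definition hgweight (b c : R) (k : nat) : R := poch b k / (poch c k * INR (fact k)).

Lemma hgcoef_weight (a b c : R) (k : nat) : hgcoef a b c k = hgweight b c k * poch a k.
Proof. unfold hgcoef, hgweight, Rdiv; ring. Qed.

Lemma hgweight_pos (b c : R) (k : nat) : 0 < b -> 0 < c -> 0 < hgweight b c k.
Proof.
  intros Hb Hc. apply Rdiv_lt_0_compat; [apply poch_pos, Hb|].
  apply Rmult_lt_0_compat; [apply poch_pos, Hc|apply INR_fact_lt_0].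
Qed.

(** The factor 2 comes from adding the convolution to its own reversal. *)
Lemma hgcoef_mult_phi (b c p q : R) (k : nat) :
  2 * PS_mult (hgcoef p b c) (hgcoef q b c) k
  = sum_f_R0 (fun j => hgweight b c j * hgweight b c (k - j) * phi k p q j) k.
Proof.
  unfold PS_mult.
  set (T := fun j => hgcoef p b c j * hgcoef q b c (k - j)%nat).
  transitivity (sum_f_R0 T k + sum_f_R0 (fun j => T (k - j)%nat) k).
  { rewrite sum_f_R0_skip. ring. }
  rewrite <- plus_sum. apply sum_eq. intros j Hj. unfold T, phi.
  rewrite !hgcoef_weight. replace (k - (k - j))%nat with j by lia. ring.
Qed.

Lemma hgcoef_mult_comm (b c p q : R) (k : nat) :
  PS_mult (hgcoef p b c) (hgcoef q b c) k = PS_mult (hgcoef q b c) (hgcoef p b c) k.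
Proof.
  assert (H : 2 * PS_mult (hgcoef p b c) (hgcoef q b c) k
            = 2 * PS_mult (hgcoef q b c) (hgcoef p b c) k); [|lra].
  rewrite !hgcoef_mult_phi. apply sum_eq. intros j _. rewrite phi_comm. ring.
Qed.

(** Successive quotients are [(b+n)/(c+n) = 1 + (b-c)/(c+n)], strictly decreasing in [n]. *)
Lemma poch_ratio_log_concave (b c : R) (i l : nat) : 0 < c < b -> (i < l)%nat ->
  poch b i / poch c i * (poch b (S l) / poch c (S l))
  < poch b (S i) / poch c (S i) * (poch b l / poch c l).
Proof.
  intros Hbc Hil. pose proof (lt_INR _ _ Hil) as HI. pose proof (pos_INR i) as Hi.
  assert (Hc : forall n, 0 < poch c n) by (intros; apply poch_pos; lra).
  assert (Hb : forall n, 0 < poch b n) by (intros; apply poch_pos; lra).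
  pose proof (Hc i). pose proof (Hc l). pose proof (Hb i). pose proof (Hb l).
  simpl poch.
  replace (poch b i / poch c i * (poch b l * (b + INR l) / (poch c l * (c + INR l))))
    with (poch b i / poch c i * (poch b l / poch c l) * ((b + INR l) / (c + INR l)))
    by (field; lra).
  replace (poch b i * (b + INR i) / (poch c i * (c + INR i)) * (poch b l / poch c l))
    with (poch b i / poch c i * (poch b l / poch c l) * ((b + INR i) / (c + INR i)))
    by (field; lra).
  apply Rmult_lt_compat_l.
  - apply Rmult_lt_0_compat; apply Rdiv_lt_0_compat; assumption.
  - assert (0 < (b + INR i) / (c + INR i) - (b + INR l) / (c + INR l)); [|lra].
    replace ((b + INR i) / (c + INR i) - (b + INR l) / (c + INR l))
      with ((b - c) * (INR l - INR i) / ((c + INR i) * (c + INR l))) by (field; lra).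
    apply Rdiv_lt_0_compat; apply Rmult_lt_0_compat; lra.
Qed.

(** The factorials are put into [D], not [G]: the sum of [D] is then a difference of two Vandermonde
    sums with equal [p + q], and [G] keeps only the log-concave sequence. *)
Lemma hgcoef_mult_lt (b c p q r t : R) (k : nat) :
  0 < c < b -> 0 <= r < p -> p <= q -> p + q = r + t -> (2 <= k)%nat ->
  PS_mult (hgcoef r b c) (hgcoef t b c) k < PS_mult (hgcoef p b c) (hgcoef q b c) k.
Proof.
  intros Hbc Hr Hpq Hs Hk.
  assert (H : 2 * PS_mult (hgcoef r b c) (hgcoef t b c) k
            < 2 * PS_mult (hgcoef p b c) (hgcoef q b c) k); [|lra].
  rewrite !hgcoef_mult_phi.
  set (G := fun j => poch b j / poch c j * (poch b (k - j) / poch c (k - j))).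
  set (u := fun j => / (INR (fact j) * INR (fact (k - j)))).
  set (D := fun j => u j * (phi k p q j - phi k r t j)).
  assert (Hu : forall j, 0 < u j).
  { intros j. apply Rinv_0_lt_compat, Rmult_lt_0_compat; apply INR_fact_lt_0. }
  assert (HU : forall y z, sum_f_R0 (fun j => u j * phi k y z j) k
                           = 2 * (poch (y + z) k / INR (fact k))).
  { intros y z. rewrite (sum_eq _ (fun j =>
      1 * (poch y j / INR (fact j) * (poch z (k - j) / INR (fact (k - j))))
      + 1 * (poch z j / INR (fact j) * (poch y (k - j) / INR (fact (k - j)))))).
    - rewrite sum_f_R0_lin, !poch_fact_vandermonde, (Rplus_comm z y). ring.
    - intros j _. unfold u, phi. field. split; apply INR_fact_neq_0. }
  assert (HP : 0 < sum_f_R0 (fun j => G j * D j) k).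
  { apply sum_unimodal_pos.
    - exact Hk.
    - intros j Hj. unfold G. replace (k - (k - j))%nat with j by lia. ring.
    - intros j Hj. unfold D. rewrite !phi_rev by exact Hj. f_equal.
      unfold u. replace (k - (k - j))%nat with j by lia. f_equal; ring.
    - intros j Hj. unfold G.
      (* Log-concavity is applied between [j] and [k - S j], which are in the right order because
         [2 * j + 2 <= k]. *)
      replace (k - j)%nat with (S (k - S j)) by lia.
      apply poch_ratio_log_concave; [exact Hbc|lia].
    - intros j Hj. unfold D. intros HD.
      assert (phi k r t j <= phi k p q j).
      { pose proof (Hu j).
        destruct (Rle_lt_dec (phi k r t j) (phi k p q j)) as [|Hlt]; [assumption|nra]. }
      apply Rmult_le_pos; [left; apply Hu|].
      assert (phi k r t (S j) <= phi k p q (S j)); [|lra].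
      apply phi_crossing; try assumption; lra.
    - unfold D, phi. rewrite Nat.sub_0_r. simpl (poch _ 0).
      destruct k as [|[|k]]; try lia.
      (* At [j = 0] the claim is strict convexity: moving [r] and [q] up by [p - r] gives [p] and
         [t]. *)
      pose proof (poch_strict_convex_pair r q (p - r) k ltac:(lra) ltac:(lra)) as HC.
      replace (r + (p - r)) with p in HC by ring.
      replace (q + (p - r)) with t in HC by lra.
      pose proof (Hu O). nra.
    - unfold D. rewrite (sum_eq _ (fun j => 1 * (u j * phi k p q j) + (-1) * (u j * phi k r t j))).
      + rewrite sum_f_R0_lin, !HU, Hs. ring.
      + intros; ring. }
  assert (Hpos : forall j, poch c j <> 0).
  { intros j. apply Rgt_not_eq, poch_pos. lra. }
  rewrite (sum_eq (fun j => G j * D j) (fun j =>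
    1 * (hgweight b c j * hgweight b c (k - j) * phi k p q j)
    + (-1) * (hgweight b c j * hgweight b c (k - j) * phi k r t j))) in HP.
  - rewrite sum_f_R0_lin in HP. lra.
  - intros j Hj. unfold G, D, u, hgweight. field.
    repeat split; try apply INR_fact_neq_0; apply Hpos.
Qed.

Lemma hgcoef_mult_shift_lt (a a' b c d : R) (k : nat) :
  0 <= a < a' -> 0 < c < b -> 0 < d -> (2 <= k)%nat ->
  PS_mult (hgcoef (a' + d) b c) (hgcoef a b c) k
  < PS_mult (hgcoef (a + d) b c) (hgcoef a' b c) k.
Proof.
  intros Ha Hbc Hd Hk. rewrite hgcoef_mult_comm.
  (* [hgcoef_mult_lt] wants the inner pair in increasing order, and either of [a + d], [a'] may be
     the smaller. *)
  destruct (Rle_dec (a + d) a').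
  - apply hgcoef_mult_lt; try assumption; lra.
  - rewrite (hgcoef_mult_comm b c (a + d)). apply hgcoef_mult_lt; try assumption; lra.
Qed.

(** In degrees 0 and 1 the coefficient depends on the two parameters only through their sum. *)
Lemma hgcoef_mult_shift_eq (a a' b c d : R) (k : nat) : c <> 0 -> (k < 2)%nat ->
  PS_mult (hgcoef (a' + d) b c) (hgcoef a b c) k
  = PS_mult (hgcoef (a + d) b c) (hgcoef a' b c) k.
Proof.
  intros Hc Hk. destruct k as [|[|k]]; [| |lia]; unfold PS_mult, hgcoef; simpl; field; exact Hc.
Qed.

Lemma diff_coef_mult (a a' b c d : R) (k : nat) :
  diff_coef a a' b c d k
  = PS_mult (hgcoef (a + d) b c) (hgcoef a' b c) k
    - PS_mult (hgcoef (a' + d) b c) (hgcoef a b c) k.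
Proof. unfold diff_coef, PS_mult. apply minus_sum. Qed.

(** In the factorisation [phi_factor], the hypothesis on [rho] compares the prefactors and convexity
    compares the remaining sums. *)
Lemma phi_ge_scaled (k j : nat) (x y e rho : R) :
  0 <= x < y -> 0 < e -> (2 * j <= k)%nat ->
  rho * (poch (x + e) j * poch y j) <= poch x j * poch (y + e) j ->
  rho * phi k (x + e) y j <= phi k x (y + e) j.
Proof.
  intros Hxy He Hj Hrho. pose proof (pos_INR j) as HI.
  replace k with (j + (k - 2 * j) + j)%nat by lia. rewrite !phi_factor.
  pose proof (poch_convex_pair (x + INR j) (y + INR j) e (k - 2 * j) ltac:(lra) He) as HC.
  replace (x + INR j + e) with (x + e + INR j) in HC by ring.
  replace (y + INR j + e) with (y + e + INR j) in HC by ring.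
  rewrite <- Rmult_assoc.
  eapply Rle_trans; [apply Rmult_le_compat_r, Hrho|].
  - apply Rplus_le_le_0_compat; apply poch_nonneg; lra.
  - apply Rmult_le_compat_l; [|exact HC].
    apply Rmult_le_pos; apply poch_nonneg; lra.
Qed.

Lemma hgcoef_mult_scaled (x y e b c rho : R) (k : nat) :
  0 <= x < y -> 0 < e -> 0 < b -> 0 < c ->
  (forall j, rho * (poch (x + e) j * poch y j) <= poch x j * poch (y + e) j) ->
  rho * PS_mult (hgcoef (x + e) b c) (hgcoef y b c) k
    <= PS_mult (hgcoef (y + e) b c) (hgcoef x b c) k
  /\ ((2 <= k)%nat -> rho * PS_mult (hgcoef (x + e) b c) (hgcoef y b c) k
                       < PS_mult (hgcoef (y + e) b c) (hgcoef x b c) k).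
Proof.
  intros Hxy He Hb Hc Hrho. rewrite (hgcoef_mult_comm b c (y + e)).
  set (W := fun j => hgweight b c j * hgweight b c (k - j)).
  assert (HW : forall j, 0 < W j) by (intros; apply Rmult_lt_0_compat; apply hgweight_pos; assumption).
  set (T := fun j => W j * (phi k x (y + e) j - rho * phi k (x + e) y j)).
  assert (ET : 2 * (PS_mult (hgcoef x b c) (hgcoef (y + e) b c) k
                    - rho * PS_mult (hgcoef (x + e) b c) (hgcoef y b c) k) = sum_f_R0 T k).
  { rewrite (sum_eq T (fun j => 1 * (W j * phi k x (y + e) j)
                                + (- rho) * (W j * phi k (x + e) y j)))
      by (intros; unfold T; ring).
    rewrite sum_f_R0_lin. unfold W. rewrite <- !hgcoef_mult_phi. ring. }
  assert (HT : forall j, (j <= k)%nat -> 0 <= T j).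
  { intros j Hj. apply Rmult_le_pos; [left; apply HW|].
    assert (rho * phi k (x + e) y j <= phi k x (y + e) j); [|lra].
    destruct (Nat.le_gt_cases (2 * j) k) as [H2|H2].
    - apply phi_ge_scaled; try assumption. apply Hrho.
    - rewrite <- (phi_rev k (x + e) y j Hj), <- (phi_rev k x (y + e) j Hj).
      apply phi_ge_scaled; try assumption; [lia|apply Hrho]. }
  split.
  - pose proof (sum_f_R0_nonneg T k HT). lra.
  - intros Hk. assert (0 < sum_f_R0 T k); [|lra].
    apply sum_f_R0_pos_first; [exact HT|].
    apply Rmult_lt_0_compat; [apply HW|]. unfold phi. rewrite Nat.sub_0_r. simpl (poch _ 0).
    destruct k as [|[|k]]; try lia.
    pose proof (poch_strict_convex_pair x y e k Hxy He) as HC.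
    (* At [j = 0] the hypothesis reads [rho <= 1], so strict convexity makes the first term
       positive. *)
    pose proof (Hrho O) as H0. simpl in H0.
    assert (0 <= poch (x + e) (S (S k)) + poch y (S (S k)))
      by (apply Rplus_le_le_0_compat; apply poch_nonneg; lra).
    nra.
Qed.

(** * Convergence and Euler's transformation *)

Lemma hgcoef_S (a b c : R) (k : nat) : 0 < c ->
  INR (S k) * (c + INR k) * hgcoef a b c (S k) = (a + INR k) * (b + INR k) * hgcoef a b c k.
Proof.
  intros Hc. unfold hgcoef. simpl poch. rewrite fact_simpl, mult_INR.
  pose proof (pos_INR k). assert (poch c k <> 0) by (apply Rgt_not_eq, poch_pos, Hc).
  field. repeat split; try lra; [apply INR_fact_neq_0|apply not_0_INR; lia].
Qed.

Lemma eventually_decreasing_bounded (u : nat -> R) (N : nat) :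
  (forall n, 0 <= u n) -> (forall n, (N <= n)%nat -> u (S n) <= u n) ->
  exists M, forall n, u n <= M.
Proof.
  intros Hpos Hdec. exists (sum_f_R0 u N). intros n.
  assert (Hle : forall m, (m <= N)%nat -> u m <= sum_f_R0 u N).
  { clear Hdec. induction N as [|N IH]; intros m Hm; simpl.
    - replace m with O by lia. lra.
    - destruct (Nat.eq_dec m (S N)) as [->|].
      + pose proof (sum_f_R0_nonneg u N (fun j _ => Hpos j)). lra.
      + pose proof (IH m ltac:(lia)). pose proof (Hpos (S N)). lra. }
  destruct (Nat.le_gt_cases n N) as [Hn|Hn]; [apply Hle, Hn|].
  apply Rle_trans with (u N); [|apply Hle; lia].
  replace n with (N + (n - N))%nat by lia. induction (n - N)%nat as [|l IH].
  - rewrite Nat.add_0_r; lra.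
  - rewrite Nat.add_succ_r. eapply Rle_trans; [apply Hdec; lia|exact IH].
Qed.

Lemma hgcoef_growth (a b c rho : R) : 0 < c -> 0 < rho < 1 ->
  exists N, forall n, (N <= n)%nat ->
    Rabs ((a + INR n) * (b + INR n)) * rho <= INR (S n) * (c + INR n).
Proof.
  intros Hc Hrho.
  (* [K] is chosen so that [m >= K + 1] gives [(A+B) m + A B <= (1-rho) m^2], whence
     [(A+m)(B+m) rho <= m^2]. *)
  set (A := Rabs a). set (B := Rabs b). set (K := (A + B + A * B) / (1 - rho)).
  assert (HA : 0 <= A) by apply Rabs_pos. assert (HB : 0 <= B) by apply Rabs_pos.
  destruct (nfloor_ex (K + 1)) as [N HN].
  { assert (0 <= K); [|lra]. apply Rdiv_le_0_compat; nra. }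
  exists (S N). intros n Hn. apply le_INR in Hn. rewrite S_INR in Hn. rewrite S_INR.
  set (m := INR n) in *.
  assert (Hm : K + 1 <= m) by lra.
  assert (HK : A + B + A * B = K * (1 - rho)) by (unfold K; field; lra).
  assert (HK0 : 0 <= K) by (apply Rdiv_le_0_compat; nra).
  rewrite Rabs_mult.
  assert (H1 : Rabs (a + m) <= A + m).
  { eapply Rle_trans; [apply Rabs_triang|]. rewrite (Rabs_right m); unfold A; lra. }
  assert (H2 : Rabs (b + m) <= B + m).
  { eapply Rle_trans; [apply Rabs_triang|]. rewrite (Rabs_right m); unfold B; lra. }
  apply Rle_trans with ((A + m) * (B + m) * rho).
  { apply Rmult_le_compat_r; [lra|].
    apply Rmult_le_compat; try apply Rabs_pos; assumption. }
  assert (A * B <= A * B * m) by (assert (0 <= A * B) by (apply Rmult_le_pos; lra); nra).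
  assert ((A + B) * m + A * B <= K * (1 - rho) * m) by (rewrite <- HK; lra).
  assert (K * (1 - rho) * m <= m * (1 - rho) * m).
  { apply Rmult_le_compat_r; [lra|]. apply Rmult_le_compat_r; lra. }
  assert (0 <= A * m) by (apply Rmult_le_pos; lra).
  assert (0 <= B * m) by (apply Rmult_le_pos; lra).
  assert (0 <= A * B) by (apply Rmult_le_pos; lra).
  nra.
Qed.

(** For [rho] halfway between [Rabs x] and 1, the absolute terms at [rho] eventually decrease by
    [hgcoef_growth], so they are bounded. *)
Lemma CV_radius_hgcoef (a b c x : R) : 0 < c -> Rabs x < 1 ->
  Rbar_lt (Rabs x) (CV_radius (hgcoef a b c)).
Proof.
  intros Hc Hx. pose proof (Rabs_pos x) as Hx0.
  set (rho := (1 + Rabs x) / 2).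
  assert (Hrho : 0 < rho < 1) by (unfold rho; lra).
  apply Rbar_lt_le_trans with (Finite rho); [simpl; unfold rho; lra|].
  apply (CV_radius_bounded (hgcoef a b c)).
  destruct (hgcoef_growth a b c rho Hc Hrho) as [N HN].
  apply eventually_decreasing_bounded with N; [intros; apply Rabs_pos|].
  intros n Hn. pose proof (pos_INR n).
  assert (Hs : 0 < INR (S n) * (c + INR n)).
  { apply Rmult_lt_0_compat; [apply lt_0_INR; lia|lra]. }
  rewrite !Rabs_mult. simpl pow. rewrite Rabs_mult, (Rabs_right rho) by lra.
  apply Rmult_le_reg_l with (INR (S n) * (c + INR n)); [exact Hs|].
  assert (E : INR (S n) * (c + INR n) * Rabs (hgcoef a b c (S n))
              = Rabs ((a + INR n) * (b + INR n)) * Rabs (hgcoef a b c n)).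
  { rewrite <- (Rabs_right (INR (S n) * (c + INR n))) by lra.
    rewrite <- !Rabs_mult, hgcoef_S by exact Hc. reflexivity. }
  rewrite <- Rmult_assoc, E.
  replace (Rabs ((a + INR n) * (b + INR n)) * Rabs (hgcoef a b c n) * (rho * Rabs (rho ^ n)))
    with (Rabs ((a + INR n) * (b + INR n)) * rho * (Rabs (hgcoef a b c n) * Rabs (rho ^ n)))
    by ring.
  apply Rmult_le_compat_r; [apply Rmult_le_pos; apply Rabs_pos|apply HN, Hn].
Qed.

Lemma hgseries_mult (a a' b b' c x : R) : 0 < c -> Rabs x < 1 ->
  hgseries a b c x * hgseries a' b' c x = PSeries (PS_mult (hgcoef a b c) (hgcoef a' b' c)) x.
Proof. intros Hc Hx. symmetry. apply PSeries_mult; apply CV_radius_hgcoef; assumption. Qed.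

Lemma ex_pseries_hgcoef_mult (a a' b b' c x : R) : 0 < c -> Rabs x < 1 ->
  ex_pseries (PS_mult (hgcoef a b c) (hgcoef a' b' c)) x.
Proof. intros Hc Hx. apply ex_pseries_mult; apply CV_radius_hgcoef; assumption. Qed.

(** With [b = c] the coefficient is [(s)_k / k!], that of [(1-x)^(-s)]; this encoding lets the
    binomial series reuse the hypergeometric lemmas. *)
Lemma hgcoef_binomial_S (s c : R) (k : nat) : 0 < c ->
  INR (S k) * hgcoef s c c (S k) = (s + INR k) * hgcoef s c c k.
Proof.
  intros Hc. pose proof (pos_INR k). apply Rmult_eq_reg_l with (c + INR k); [|lra].
  rewrite <- Rmult_assoc, (Rmult_comm (c + INR k)), hgcoef_S by exact Hc. ring.
Qed.

Lemma hgseries_binomial_derive (s c x : R) : 0 < c -> Rabs x < 1 ->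
  is_derive (hgseries s c c) x (s * hgseries s c c x / (1 - x)).
Proof.
  intros Hc Hx. set (e := hgcoef s c c).
  assert (Hcv : Rbar_lt (Rabs x) (CV_radius e)) by (apply CV_radius_hgcoef; assumption).
  assert (Hx1 : 1 - x <> 0) by (apply Rabs_def2 in Hx; lra).
  replace (s * hgseries s c c x / (1 - x)) with (PSeries (PS_derive e) x).
  { exact (is_derive_PSeries e x Hcv). }
  assert (Hd : ex_pseries (PS_derive e) x) by (apply ex_pseries_derive, Hcv).
  assert (He : ex_pseries e x) by (apply CV_radius_inside, Hcv).
  (* The coefficient recurrence, read as an identity of series: [f' = s f + x f']. *)
  assert (E : PSeries (PS_derive e) x = s * PSeries e x + x * PSeries (PS_derive e) x).
  { rewrite <- PSeries_incr_1, <- PSeries_scal, <- PSeries_plus.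
    - apply PSeries_ext. intros n. unfold PS_derive at 1. unfold e.
      rewrite hgcoef_binomial_S by exact Hc.
      unfold PS_plus, PS_scal. destruct n as [|n].
      + simpl. unfold plus, scal, zero; simpl; unfold mult; simpl. ring.
      + change ((s + INR (S n)) * hgcoef s c c (S n)
                = s * hgcoef s c c (S n) + INR (S n) * hgcoef s c c (S n)). ring.
    - apply ex_pseries_scal; [apply Rmult_comm|exact He].
    - apply ex_pseries_incr_1, Hd. }
  change (hgseries s c c x) with (PSeries e x).
  apply Rmult_eq_reg_r with (1 - x); [|exact Hx1].
  field_simplify; [|exact Hx1]. lra.
Qed.

(** By the differential equation, [f(t) (1-t)^s] has zero derivative; its value at [0] is 1. *)
Lemma hgseries_binomial (s c y : R) : 0 < c -> 0 < y < 1 ->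
  hgseries s c c y = Rpower (1 - y) (- s).
Proof.
  intros Hc Hy.
  assert (E : hgseries s c c 0 * Rpower (1 - 0) s = hgseries s c c y * Rpower (1 - y) s).
  { apply (eq_is_derive (fun t => hgseries s c c t * Rpower (1 - t) s)); [|lra].
    intros t Ht.
    assert (H1 := hgseries_binomial_derive s c t Hc ltac:(apply Rabs_def1; lra)).
    assert (H2 : is_derive (fun t => Rpower (1 - t) s) t (- s * Rpower (1 - t) s / (1 - t))).
    { unfold Rpower. auto_derive; [lra|]. change (1 + - t) with (1 - t). field. lra. }
    assert (H3 := is_derive_mult _ _ _ _ _ H1 H2 (fun _ _ => Rmult_comm _ _)).
    refine (eq_rect _ (is_derive _ t) H3 _ _).
    unfold plus, mult, zero; simpl. field. lra. }
  assert (E0 : hgseries s c c 0 = 1).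
  { change (PSeries (hgcoef s c c) 0 = 1). rewrite PSeries_0. unfold hgcoef; simpl; field. }
  rewrite E0, Rminus_0_r in E. unfold Rpower at 1 in E. rewrite ln_1, Rmult_0_r, exp_0 in E.
  rewrite Rpower_Ropp. assert (0 < Rpower (1 - y) s) by apply exp_pos.
  apply Rmult_eq_reg_r with (Rpower (1 - y) s); [|lra].
  rewrite <- E. field. lra.
Qed.

(* The first-order recurrence of the convolution is telescoped by the certificate
   [- i (c+i-1) h_i e_(n+1-i)], where [h], [e] are the two coefficient sequences. *)
Lemma hgcoef_euler (a b c : R) (n : nat) : 0 < c ->
  PS_mult (hgcoef (c - a) (c - b) c) (hgcoef (a + b - c) c c) n = hgcoef a b c n.
Proof.
  intros Hc. set (h := hgcoef (c - a) (c - b) c). set (e := hgcoef (a + b - c) c c).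
  induction n as [|n IH].
  { unfold PS_mult, h, e, hgcoef; simpl; field. }
  assert (Hn : 0 < INR (S n) * (c + INR n)).
  { pose proof (pos_INR n). apply Rmult_lt_0_compat; [apply lt_0_INR; lia|lra]. }
  apply Rmult_eq_reg_l with (INR (S n) * (c + INR n)); [|lra].
  rewrite hgcoef_S, <- IH by exact Hc. unfold PS_mult. rewrite tech5, Nat.sub_diag.
  assert (Htel : forall N, (N <= n)%nat ->
    INR (S n) * (c + INR n) * sum_f_R0 (fun i => h i * e (S n - i)%nat) N
    - (a + INR n) * (b + INR n) * sum_f_R0 (fun i => h i * e (n - i)%nat) N
    = - (INR (S N) * (c + INR N) * h (S N) * e (n - N)%nat)).
  { assert (Hstep : forall i, (i <= n)%nat ->
      INR (S n) * (c + INR n) * (h i * e (S n - i)%nat)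
      - (a + INR n) * (b + INR n) * (h i * e (n - i)%nat)
      = - (INR (S i) * (c + INR i) * h (S i) * e (n - i)%nat)
        + INR i * (c + INR i - 1) * h i * e (S n - i)%nat).
    { intros i Hi. unfold h at 3. rewrite hgcoef_S by exact Hc. fold h.
      replace (S n - i)%nat with (S (n - i)) by lia.
      assert (He : INR (S (n - i)) * e (S (n - i)) = (a + b - c + INR (n - i)) * e (n - i)%nat)
        by (apply hgcoef_binomial_S, Hc).
      assert (HI : INR n = INR i + INR (n - i)) by (rewrite minus_INR by lia; ring).
      rewrite S_INR in He. rewrite S_INR, HI. pose proof (pos_INR (n - i)).
      (* After multiplication by [n - i + 1], the difference of the two sides is a multiple of the
         recurrence [He]. *)
      apply Rmult_eq_reg_l with (INR (n - i) + 1); [|lra].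
      generalize dependent (INR (n - i)). intros m.
      generalize (INR i) (h i) (e (n - i)%nat) (e (S (n - i))). intros I H0 x y He _ Hm.
      match goal with |- ?L = ?R' => assert (Z : L - R' = 0); [|lra] end.
      transitivity ((((m + 1) * y) - (a + b - c + m) * x)
         * H0 * ((I + m + 1) * (c + (I + m)) - I * (c + I - 1))); [ring|].
      rewrite He. ring. }
    induction N as [|N IHN]; intros HN.
    - simpl sum_f_R0. rewrite Hstep by lia. simpl (INR 0). ring.
    - rewrite !tech5, !Rmult_plus_distr_l.
      pose proof (IHN ltac:(lia)) as H1. pose proof (Hstep (S N) HN) as H2.
      replace (S n - S N)%nat with (n - N)%nat in H2 |- * by lia.
      rewrite (S_INR N) in H1, H2 |- *.
      replace (c + (INR N + 1) - 1) with (c + INR N) in H2 by ring.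
      lra. }
  (* At [N = n] the boundary term cancels the last term of the convolution, split off by [tech5]. *)
  specialize (Htel n (Nat.le_refl n)). rewrite Nat.sub_diag in Htel. lra.
Qed.

Lemma hgseries_euler (a b c y : R) : 0 < c -> 0 < y < 1 ->
  hgseries a b c y = Rpower (1 - y) (c - a - b) * hgseries (c - a) (c - b) c y.
Proof.
  intros Hc Hy.
  replace (c - a - b) with (- (a + b - c)) by ring.
  rewrite <- (hgseries_binomial (a + b - c) c y Hc Hy), Rmult_comm.
  rewrite hgseries_mult by (try apply Rabs_def1; lra).
  symmetry. apply PSeries_ext. intros n. apply hgcoef_euler, Hc.
Qed.

(** * Positivity and comparison of power series *)

Lemma Series_pos (u : nat -> R) (k : nat) :
  ex_series u -> (forall n, 0 <= u n) -> 0 < u k -> 0 < Series u.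
Proof.
  intros Hex Hu Hk. rewrite (Series_incr_n u (S k)); [|lia|exact Hex].
  apply Rplus_lt_le_0_compat.
  - simpl pred. destruct k as [|k]; simpl; [exact Hk|].
    apply Rplus_le_lt_0_compat; [|exact Hk]. apply sum_f_R0_nonneg. intros; apply Hu.
  - set (v := fun n => u (S k + n)%nat). rewrite <- (Rmult_0_l (Series v)), <- Series_scal_l.
    apply Series_le; [intros; rewrite Rmult_0_l; split; [lra|apply Hu]|].
    apply ex_series_incr_n, Hex.
Qed.

Lemma PSeries_lt (u v : nat -> R) (x : R) (k : nat) : 0 < x ->
  ex_pseries u x -> ex_pseries v x -> (forall n, u n <= v n) -> u k < v k ->
  PSeries u x < PSeries v x.
Proof.
  intros Hx Hu Hv Hle Hlt.
  assert (0 < PSeries (PS_minus v u) x).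
  { unfold PSeries. apply Series_pos with k.
    - assert (H : ex_pseries (PS_minus v u) x) by (apply ex_pseries_minus; assumption).
      revert H. unfold ex_pseries, ex_series, is_pseries. intros [l Hl]. exists l.
      revert Hl. apply is_series_ext. intros n. rewrite pow_n_pow. apply Rmult_comm.
    - intros n. apply Rmult_le_pos; [|apply pow_le; lra]. specialize (Hle n).
      unfold PS_minus, PS_plus, PS_opp, plus, opp; simpl. lra.
    - apply Rmult_lt_0_compat; [|apply pow_lt; lra].
      unfold PS_minus, PS_plus, PS_opp, plus, opp; simpl. lra. }
  rewrite PSeries_minus in H by assumption. lra.
Qed.

Lemma hgseries_pos (a b c x : R) : 0 <= a -> 0 < b -> 0 < c -> 0 < x < 1 -> 0 < hgseries a b c x.
Proof.
  intros Ha Hb Hc Hx. change (0 < PSeries (hgcoef a b c) x).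
  rewrite <- (PSeries_const_0 x). apply PSeries_lt with O.
  - lra.
  - apply CV_radius_inside. rewrite CV_radius_const_0. exact I.
  - apply CV_radius_inside, CV_radius_hgcoef; [exact Hc|apply Rabs_def1; lra].
  - intros n. rewrite hgcoef_weight. apply Rmult_le_pos; [left; apply hgweight_pos; assumption|].
    apply poch_nonneg, Ha.
  - unfold hgcoef; simpl. lra.
Qed.

Lemma hgseries_shift_lt (a a' b c d x : R) :
  0 <= a < a' -> 0 < c < b -> 0 < d -> 0 < x < 1 ->
  hgseries (a' + d) b c x * hgseries a b c x < hgseries (a + d) b c x * hgseries a' b c x.
Proof.
  intros Ha Hbc Hd Hx.
  assert (Hx1 : Rabs x < 1) by (apply Rabs_def1; lra).
  rewrite !hgseries_mult by lra.
  (* Degree 2 is the first one in which the coefficients differ. *)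
  apply PSeries_lt with 2%nat; try lra; try (apply ex_pseries_hgcoef_mult; lra).
  - intros n. destruct (Nat.le_gt_cases 2 n).
    + left; apply hgcoef_mult_shift_lt; assumption.
    + right; apply hgcoef_mult_shift_eq; [lra|lia].
  - apply hgcoef_mult_shift_lt; try assumption; lia.
Qed.

Lemma hgseries_shift_scaled (x y e b c rho z : R) :
  0 <= x < y -> 0 < e -> 0 < b -> 0 < c -> 0 < z < 1 ->
  (forall j, rho * (poch (x + e) j * poch y j) <= poch x j * poch (y + e) j) ->
  rho * (hgseries (x + e) b c z * hgseries y b c z)
  < hgseries (y + e) b c z * hgseries x b c z.
Proof.
  intros Hxy He Hb Hc Hz Hrho.
  assert (Hz1 : Rabs z < 1) by (apply Rabs_def1; lra).
  rewrite !hgseries_mult by lra. rewrite <- PSeries_scal.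
  apply PSeries_lt with 2%nat; try lra.
  - apply ex_pseries_scal; [apply Rmult_comm|]. apply ex_pseries_hgcoef_mult; lra.
  - apply ex_pseries_hgcoef_mult; lra.
  - intros n. apply (hgcoef_mult_scaled x y e b c rho n); assumption.
  - apply (hgcoef_mult_scaled x y e b c rho 2); try assumption; lia.
Qed.

(** * The Gamma function *)

Definition gamma_integrand (s t : R) : R := Rpower t (s - 1) * exp (- t).

Lemma gamma_integrand_pos (s t : R) : 0 < gamma_integrand s t.
Proof. apply Rmult_lt_0_compat; apply exp_pos. Qed.

Lemma gamma_integrand_continuous (s t : R) : 0 < t -> continuous (gamma_integrand s) t.
Proof.
  intros Ht. apply (ex_derive_continuous (gamma_integrand s)).
  unfold gamma_integrand, Rpower. auto_derive. exact Ht.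
Qed.

Lemma ex_RInt_pos_continuous (f : R -> R) (a b : R) :
  (forall x, 0 < x -> continuous f x) -> 0 < a <= b -> ex_RInt f a b.
Proof.
  intros Hf Hab. apply (ex_RInt_continuous f). intros z Hz.
  rewrite Rmin_left in Hz by lra. apply Hf; lra.
Qed.

Lemma RInt_nonneg_widen (f : R -> R) (a a0 b0 b : R) :
  (forall x, 0 < x -> 0 <= f x) -> (forall x, 0 < x -> continuous f x) ->
  0 < a <= a0 -> a0 <= b0 -> b0 <= b -> RInt f a0 b0 <= RInt f a b.
Proof.
  intros Hpos Hcont Ha H0 Hb.
  assert (Hex : forall u v, 0 < u <= v -> ex_RInt f u v)
    by (intros; apply ex_RInt_pos_continuous; assumption).
  rewrite <- (RInt_Chasles f a a0 b) by (apply Hex; lra).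
  rewrite <- (RInt_Chasles f a0 b0 b) by (apply Hex; lra).
  assert (0 <= RInt f a a0) by (apply RInt_ge_0; [lra|apply Hex; lra|intros; apply Hpos; lra]).
  assert (0 <= RInt f b0 b) by (apply RInt_ge_0; [lra|apply Hex; lra|intros; apply Hpos; lra]).
  unfold plus; simpl. lra.
Qed.

Lemma filter_prod_0_infty (a0 b0 : R) (P : R * R -> Prop) : 0 < a0 ->
  (forall a b, 0 < a < a0 -> b0 < b -> P (a, b)) ->
  filter_prod (at_right 0) (Rbar_locally p_infty) P.
Proof.
  intros Ha0 HP.
  apply Filter_prod with (fun a => 0 < a < a0) (fun b => b0 < b).
  - exists (mkposreal a0 Ha0). intros y Hy Hy0.
    unfold ball in Hy; simpl in Hy; unfold AbsRing_ball, abs, minus, plus, opp in Hy; simpl in Hy.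
    apply Rabs_def2 in Hy. lra.
  - exists b0. auto.
  - exact HP.
Qed.

(** Monotone convergence: the improper integral is the supremum of the integrals over compact
    intervals. *)
Lemma ex_RInt_gen_nonneg_bounded (f : R -> R) (M : R) :
  (forall x, 0 < x -> 0 <= f x) -> (forall x, 0 < x -> continuous f x) ->
  (forall a b, 0 < a <= b -> RInt f a b <= M) ->
  ex_RInt_gen f (at_right 0) (Rbar_locally p_infty).
Proof.
  intros Hpos Hcont HM.
  destruct (completeness (fun y => exists a b, 0 < a <= b /\ y = RInt f a b)) as [l [Hub Hlub]].
  - exists M. intros y [a [b [Hab ->]]]. apply HM, Hab.
  - exists (RInt f 1 1), 1, 1. split; [lra|reflexivity].
  - exists l. intros P [eps Heps].
    assert (H : exists a0 b0, 0 < a0 <= b0 /\ l - eps < RInt f a0 b0).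
    { apply Classical_Prop.NNPP. intros Hno.
      assert (l <= l - eps); [|pose proof (cond_pos eps); lra].
      apply Hlub. intros y [a [b [Hab ->]]]. apply Rnot_lt_le. intros Hlt.
      apply Hno. exists a, b. split; assumption. }
    destruct H as [a0 [b0 [Hab0 Hlt]]].
    apply (filter_prod_0_infty a0 b0); [lra|]. intros a b Ha Hb. simpl.
    exists (RInt f a b). split.
    + apply (RInt_correct (V := R_CompleteNormedModule)), ex_RInt_pos_continuous; [exact Hcont|lra].
    + apply Heps. unfold ball; simpl; unfold AbsRing_ball, abs, minus, plus, opp; simpl.
      assert (RInt f a0 b0 <= RInt f a b) by (apply RInt_nonneg_widen; try assumption; lra).
      assert (RInt f a b <= l) by (apply Hub; exists a, b; split; [lra|reflexivity]).
      pose proof (cond_pos eps). apply Rabs_def1; lra.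
Qed.

(** In logarithms this is [ln v <= v] at [v = (1+u)/(s+1)], multiplied by [s + 1]. *)
Lemma Rpower_exp_bound (s u : R) : 0 < s -> 0 < u ->
  Rpower (1 + u) (s + 1) * exp (- u) <= exp (1 + (s + 1) * ln (s + 1)).
Proof.
  intros Hs Hu. unfold Rpower. rewrite <- exp_plus.
  assert (Hle : (s + 1) * ln (1 + u) + - u <= 1 + (s + 1) * ln (s + 1)).
  { assert (E : ln (1 + u) = ln ((1 + u) / (s + 1)) + ln (s + 1)).
    { rewrite <- ln_mult; [f_equal; field; lra|apply Rdiv_lt_0_compat; lra|lra]. }
    assert (L : ln ((1 + u) / (s + 1)) <= (1 + u) / (s + 1)).
    { left. apply exp_lt_inv. assert (0 < (1 + u) / (s + 1)) by (apply Rdiv_lt_0_compat; lra).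
      rewrite exp_ln by assumption. pose proof (exp_ineq1_le ((1 + u) / (s + 1))). lra. }
    apply (Rmult_le_compat_l (s + 1)) in L; [|lra].
    replace ((s + 1) * ((1 + u) / (s + 1))) with (1 + u) in L by (field; lra).
    rewrite E. lra. }
  destruct Hle as [Hle|Hle]; [left; apply exp_increasing, Hle|right; f_equal; exact Hle].
Qed.

(* Domination by a multiple of the derivative of [(u / (1+u))^s / s], which stays in [0, 1/s]. *)
Lemma gamma_integrand_RInt_bound (s a b : R) : 0 < s -> 0 < a <= b ->
  RInt (gamma_integrand s) a b <= exp (1 + (s + 1) * ln (s + 1)) / s.
Proof.
  intros Hs Hab. set (C := exp (1 + (s + 1) * ln (s + 1))).
  assert (HC : 0 < C) by apply exp_pos.
  set (h := fun u => C / s * Rpower (u / (1 + u)) s).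
  set (dh := fun u => C * (Rpower u (s - 1) * Rpower (1 + u) (- (s + 1)))).
  assert (Hdh : forall u, 0 < u -> is_derive h u (dh u)).
  { intros u Hu. unfold h, dh, Rpower. auto_derive.
    - split; [lra|]. split; [apply Rdiv_lt_0_compat; lra|exact I].
    - unfold Rdiv. rewrite ln_mult, ln_Rinv by (try apply Rinv_0_lt_compat; lra).
      replace (s * (ln u + - ln (1 + u))) with ((s - 1) * ln u + - (s + 1) * ln (1 + u)
        + (ln u + ln (1 + u))) by ring.
      rewrite !exp_plus, !exp_ln by lra. field. lra. }
  assert (Hcont : forall u, 0 < u -> continuous dh u).
  { intros u Hu. apply (ex_derive_continuous dh). unfold dh, Rpower. auto_derive. lra. }
  assert (Hint : is_RInt dh a b (minus (h b) (h a))).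
  { apply (is_RInt_derive (V := R_CompleteNormedModule) h dh); intros u Hu; rewrite Rmin_left in Hu by lra;
      [apply Hdh|apply Hcont]; lra. }
  apply Rle_trans with (RInt dh a b).
  - apply RInt_le; [lra| | |].
    + apply ex_RInt_pos_continuous; [apply gamma_integrand_continuous|exact Hab].
    + exists (minus (h b) (h a)). exact Hint.
    + intros u Hu. unfold gamma_integrand, dh.
      pose proof (Rpower_exp_bound s u Hs ltac:(lra)) as HB. fold C in HB.
      assert (HR : 0 < Rpower (1 + u) (s + 1)) by apply exp_pos.
      assert (HU : 0 < Rpower u (s - 1)) by apply exp_pos.
      rewrite Rpower_Ropp.
      replace (C * (Rpower u (s - 1) * / Rpower (1 + u) (s + 1)))
        with (Rpower u (s - 1) * (C * / Rpower (1 + u) (s + 1))) by ring.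
      apply Rmult_le_compat_l; [lra|].
      apply Rmult_le_reg_r with (Rpower (1 + u) (s + 1)); [exact HR|].
      rewrite Rmult_assoc, Rinv_l by lra. lra.
  - rewrite (is_RInt_unique _ _ _ _ Hint).
    assert (Hb1 : Rpower (b / (1 + b)) s <= 1).
    { apply Rle_trans with (exp 0); [|rewrite exp_0; lra].
      left. apply exp_increasing.
      assert (ln (b / (1 + b)) < 0); [|nra].
      rewrite <- ln_1. apply ln_increasing; [apply Rdiv_lt_0_compat; lra|].
      apply Rmult_lt_reg_r with (1 + b); [lra|]. field_simplify; lra. }
    assert (0 < h a) by (apply Rmult_lt_0_compat; [apply Rdiv_lt_0_compat; lra|apply exp_pos]).
    assert (h b <= C / s * 1).
    { apply Rmult_le_compat_l; [|exact Hb1]. left; apply Rdiv_lt_0_compat; lra. }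
    unfold minus, plus, opp; simpl. lra.
Qed.

Lemma is_RInt_gen_Gamma (s : R) : 0 < s ->
  is_RInt_gen (gamma_integrand s) (at_right 0) (Rbar_locally p_infty) (Gamma s).
Proof.
  intros Hs. apply (RInt_gen_correct (V := R_CompleteNormedModule) (gamma_integrand s)).
  apply ex_RInt_gen_nonneg_bounded with (exp (1 + (s + 1) * ln (s + 1)) / s).
  - intros; left; apply gamma_integrand_pos.
  - apply gamma_integrand_continuous.
  - intros; apply gamma_integrand_RInt_bound; assumption.
Qed.

Lemma is_RInt_gen_nonneg_le (f g : R -> R) (lf lg : R) :
  (forall x, 0 < x -> 0 <= f x <= g x) ->
  is_RInt_gen f (at_right 0) (Rbar_locally p_infty) lf ->
  is_RInt_gen g (at_right 0) (Rbar_locally p_infty) lg -> lf <= lg.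
Proof.
  intros Hfg Hf Hg. apply Rle_trans with (norm lf); [apply Rle_abs|].
  apply (RInt_gen_norm (V := R_CompleteNormedModule) (Fa := at_right 0)
    (Fb := Rbar_locally p_infty) f g); [| |exact Hf|exact Hg].
  - apply (filter_prod_0_infty 1 1); [lra|]. intros; simpl; lra.
  - apply (filter_prod_0_infty 1 1); [lra|]. intros a b Ha Hb x Hx. simpl in Hx.
    specialize (Hfg x ltac:(lra)). unfold norm; simpl; unfold abs; simpl.
    rewrite Rabs_right; lra.
Qed.

Lemma is_RInt_gen_ge_RInt (f : R -> R) (l a b : R) :
  (forall x, 0 < x -> 0 <= f x) -> (forall x, 0 < x -> continuous f x) -> 0 < a <= b ->
  is_RInt_gen f (at_right 0) (Rbar_locally p_infty) l -> RInt f a b <= l.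
Proof.
  intros Hpos Hcont Hab Hl. apply Rnot_lt_le. intros Hlt.
  assert (He : 0 < RInt f a b - l) by lra.
  assert (HP : filter_prod (at_right 0) (Rbar_locally p_infty)
    (fun ab => exists y, is_RInt f (fst ab) (snd ab) y /\ y < RInt f a b)).
  { apply (Hl (fun y => y < RInt f a b)). exists (mkposreal _ He). intros y Hy.
    unfold ball in Hy; simpl in Hy; unfold AbsRing_ball, abs, minus, plus, opp in Hy; simpl in Hy.
    apply Rabs_def2 in Hy. lra. }
  assert (HQ : filter_prod (at_right 0) (Rbar_locally p_infty)
    (fun ab => 0 < fst ab <= a /\ b <= snd ab)).
  { apply (filter_prod_0_infty a b); [lra|]. intros; simpl; lra. }
  (* Some interval both contains [[a, b]] and has integral below [RInt f a b], contradicting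
     monotonicity. *)
  destruct (filter_ex _ (filter_and _ _ HP HQ)) as [[u v] [[y [Hy Hlty]] [Hu Hv]]].
  simpl in *. apply (is_RInt_unique (V := R_CompleteNormedModule)) in Hy.
  assert (RInt f a b <= RInt f u v) by (apply RInt_nonneg_widen; try assumption; lra).
  lra.
Qed.

Lemma Gamma_pos (s : R) : 0 < s -> 0 < Gamma s.
Proof.
  intros Hs. apply Rlt_le_trans with (RInt (gamma_integrand s) 1 2).
  - apply RInt_gt_0; [lra|intros; apply gamma_integrand_pos|].
    intros x Hx. apply gamma_integrand_continuous. lra.
  - apply is_RInt_gen_ge_RInt; [| |lra|apply is_RInt_gen_Gamma, Hs].
    + intros; left; apply gamma_integrand_pos.
    + apply gamma_integrand_continuous.
Qed.

(** * The functional equation of Gamma *)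

Lemma Rpower_exp_lim_0 (s : R) : 0 < s ->
  filterlim (fun t => Rpower t s * exp (- t)) (at_right 0) (locally 0).
Proof.
  (* The radius [exp (ln eps / s)] is [eps^(1/s)]. *)
  intros Hs P [eps Heps]. assert (Hd : 0 < exp (ln eps / s)) by apply exp_pos.
  exists (mkposreal _ Hd). intros t Ht Ht0. apply Heps.
  unfold ball in Ht; simpl in Ht; unfold AbsRing_ball, abs, minus, plus, opp in Ht; simpl in Ht.
  unfold ball; simpl; unfold AbsRing_ball, abs, minus, plus, opp; simpl.
  apply Rabs_def2 in Ht.
  assert (H1 : Rpower t s < eps).
  { rewrite <- (exp_ln eps) by apply cond_pos. apply exp_increasing.
    assert (Hl : ln t < ln eps / s).
    { rewrite <- (ln_exp (ln eps / s)). apply ln_increasing; lra. }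
    apply (Rmult_lt_compat_l s) in Hl; [|lra].
    replace (s * (ln eps / s)) with (ln eps) in Hl by (field; lra). exact Hl. }
  assert (H2 : exp (- t) < 1) by (rewrite <- exp_0; apply exp_increasing; lra).
  assert (H3 : 0 < Rpower t s) by apply exp_pos. assert (H4 : 0 < exp (- t)) by apply exp_pos.
  assert (0 < Rpower t s * exp (- t)) by (apply Rmult_lt_0_compat; assumption).
  assert (Rpower t s * exp (- t) < eps) by nra.
  apply Rabs_def1; lra.
Qed.

Lemma Rpower_exp_lim_infty (s : R) : 0 < s ->
  filterlim (fun t => Rpower t s * exp (- t)) (Rbar_locally p_infty) (locally 0).
Proof.
  intros Hs P [eps Heps]. set (C := exp (1 + (s + 1) * ln (s + 1))).
  assert (HC : 0 < C) by apply exp_pos.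
  (* The threshold comes from [t^s e^(-t) (1+t) <= (1+t)^(s+1) e^(-t) <= C]. *)
  exists (C / eps). intros t Ht. apply Heps.
  unfold ball; simpl; unfold AbsRing_ball, abs, minus, plus, opp; simpl.
  pose proof (cond_pos eps) as He.
  assert (Ht0 : 0 < t) by (assert (0 < C / eps) by (apply Rdiv_lt_0_compat; lra); lra).
  pose proof (Rpower_exp_bound s t Hs Ht0) as HB. fold C in HB.
  rewrite Rpower_plus, Rpower_1 in HB by lra.
  assert (H1 : Rpower t s < Rpower (1 + t) s) by (apply Rlt_Rpower_l; lra).
  assert (H3 : 0 < Rpower t s) by apply exp_pos. assert (H4 : 0 < exp (- t)) by apply exp_pos.
  assert (0 < Rpower t s * exp (- t)) by (apply Rmult_lt_0_compat; assumption).
  assert (Rpower t s * exp (- t) < eps).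
  { apply (Rmult_lt_compat_r eps) in Ht; [|exact He].
    replace (C / eps * eps) with C in Ht by (field; lra).
    apply Rmult_lt_reg_r with (1 + t); [lra|].
    assert (Rpower t s * exp (- t) * (1 + t) <= Rpower (1 + t) s * (1 + t) * exp (- t)); [|nra].
    assert (0 < exp (- t) * (1 + t)) by (apply Rmult_lt_0_compat; lra). nra. }
  apply Rabs_def1; lra.
Qed.

(** Integration by parts: [F] vanishes at both ends, so its derivative [dF] integrates to [0]. *)
Lemma Gamma_S (s : R) : 0 < s -> Gamma (s + 1) = s * Gamma s.
Proof.
  intros Hs. set (F := fun t => Rpower t s * exp (- t)).
  set (dF := fun t => s * gamma_integrand s t - gamma_integrand (s + 1) t).
  assert (HdF : forall t, 0 < t -> is_derive F t (dF t)).
  { intros t Ht. unfold F, dF, gamma_integrand. replace (s + 1 - 1) with s by ring.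
    assert (E : Rpower t s = t * Rpower t (s - 1)).
    { rewrite <- (Rpower_1 t) at 2 by exact Ht. rewrite <- Rpower_plus. f_equal; ring. }
    unfold Rpower at 1. auto_derive; [exact Ht|]. fold (Rpower t s). rewrite E. field. lra. }
  assert (H : is_RInt_gen (Derive F) (at_right 0) (Rbar_locally p_infty) (0 - 0)).
  { apply is_RInt_gen_Derive.
    - apply (filter_prod_0_infty 1 1); [lra|]. intros a b Ha Hb x Hx. simpl in Hx.
      rewrite Rmin_left in Hx by lra. exists (dF x). apply HdF. lra.
    - apply (filter_prod_0_infty 1 1); [lra|]. intros a b Ha Hb x Hx. simpl in Hx.
      rewrite Rmin_left in Hx by lra.
      apply (continuous_ext_loc _ dF).
      (* Radius [a] keeps the ball around [x >= a] inside the positive half-line. *)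
      + exists (mkposreal a (proj1 Ha)). intros y Hy. symmetry. apply is_derive_unique, HdF.
        unfold ball in Hy; simpl in Hy; unfold AbsRing_ball, abs, minus, plus, opp in Hy;
          simpl in Hy. apply Rabs_def2 in Hy. lra.
      + apply (continuous_minus (fun t => s * gamma_integrand s t) (gamma_integrand (s + 1))).
        * apply (continuous_scal_r s (gamma_integrand s)), gamma_integrand_continuous. lra.
        * apply gamma_integrand_continuous. lra.
    - apply Rpower_exp_lim_0, Hs.
    - apply Rpower_exp_lim_infty, Hs. }
  assert (H' : is_RInt_gen dF (at_right 0) (Rbar_locally p_infty) (s * Gamma s - Gamma (s + 1))).
  { apply (is_RInt_gen_minus (fun t => s * gamma_integrand s t) (gamma_integrand (s + 1))).
    - apply (is_RInt_gen_scal (gamma_integrand s) s), is_RInt_gen_Gamma, Hs.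
    - apply is_RInt_gen_Gamma. lra. }
  apply (is_RInt_gen_ext (Derive F) dF) in H.
  - apply (is_RInt_gen_unique (V := R_CompleteNormedModule)) in H.
    apply (is_RInt_gen_unique (V := R_CompleteNormedModule)) in H'. rewrite H in H'. lra.
  - apply (filter_prod_0_infty 1 1); [lra|]. intros a b Ha Hb x Hx. simpl in Hx.
    rewrite Rmin_left in Hx by lra. apply is_derive_unique, HdF. lra.
Qed.

Lemma Gamma_poch (s : R) (j : nat) : 0 < s -> Gamma (s + INR j) = poch s j * Gamma s.
Proof.
  intros Hs. induction j as [|j IH].
  - simpl. rewrite Rplus_0_r. ring.
  - pose proof (pos_INR j). rewrite S_INR, <- Rplus_assoc, Gamma_S, IH by lra. simpl. ring.
Qed.

(** * Log-convexity of Gamma *)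

Lemma exp_convex (l x y : R) : 0 <= l <= 1 ->
  exp ((1 - l) * x + l * y) <= (1 - l) * exp x + l * exp y.
Proof.
  intros Hl. set (z := (1 - l) * x + l * y).
  (* Tangent line at [z]; in the weighted average of its values at [x] and [y] the slope terms
     cancel. *)
  assert (T : forall w, exp z * (1 + (w - z)) <= exp w).
  { intros w. replace (exp w) with (exp z * exp (w - z)) by (rewrite <- exp_plus; f_equal; ring).
    apply Rmult_le_compat_l; [left; apply exp_pos|apply exp_ineq1_le]. }
  pose proof (T x) as Tx. pose proof (T y) as Ty.
  apply (Rmult_le_compat_l (1 - l)) in Tx; [|lra].
  apply (Rmult_le_compat_l l) in Ty; [|lra].
  replace (exp z) with ((1 - l) * (exp z * (1 + (x - z))) + l * (exp z * (1 + (y - z)))).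
  - lra.
  - unfold z. ring.
Qed.

(** Hölder's inequality by normalisation: after division by [exp K], the integrand is bounded
    pointwise, by convexity of [exp], by a weighted mean of the normalised integrands at [r] and
    [t], whose integral is 1. *)
Lemma Gamma_log_convex (l r t : R) : 0 <= l <= 1 -> 0 < r -> 0 < t ->
  Gamma ((1 - l) * r + l * t) <= exp ((1 - l) * ln (Gamma r) + l * ln (Gamma t)).
Proof.
  intros Hl Hr Ht. set (K := (1 - l) * ln (Gamma r) + l * ln (Gamma t)).
  pose proof (Gamma_pos r Hr) as Gr. pose proof (Gamma_pos t Ht) as Gt.
  set (p := (1 - l) * r + l * t). assert (Hp : 0 < p) by (unfold p; nra).
  apply Rmult_le_reg_l with (exp (- K)); [apply exp_pos|].
  rewrite <- exp_plus, Rplus_opp_l, exp_0.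
  apply (is_RInt_gen_nonneg_le (fun u => exp (- K) * gamma_integrand p u)
    (fun u => (1 - l) / Gamma r * gamma_integrand r u + l / Gamma t * gamma_integrand t u)).
  - intros u Hu. split; [left; apply Rmult_lt_0_compat; [apply exp_pos|apply gamma_integrand_pos]|].
    unfold gamma_integrand, Rpower.
    pose proof (exp_convex l ((r - 1) * ln u - ln (Gamma r)) ((t - 1) * ln u - ln (Gamma t)) Hl) as H.
    replace ((1 - l) * ((r - 1) * ln u - ln (Gamma r)) + l * ((t - 1) * ln u - ln (Gamma t)))
      with (- K + (p - 1) * ln u) in H by (unfold K, p; ring).
    assert (E : forall X g, 0 < g -> exp (X - ln g) = exp X / g).
    { intros X g Hg. unfold Rminus. rewrite exp_plus, exp_Ropp, exp_ln by exact Hg. reflexivity. }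
    rewrite exp_plus, !E in H by assumption.
    apply (Rmult_le_compat_r (exp (- u))) in H; [|left; apply exp_pos].
    unfold Rdiv in *. lra.
  - apply (is_RInt_gen_scal (gamma_integrand p) (exp (- K))), is_RInt_gen_Gamma, Hp.
  - assert (E : (1 - l) / Gamma r * Gamma r + l / Gamma t * Gamma t = 1) by (field; lra).
    refine (eq_rect _ (is_RInt_gen _ _ _) _ 1 E).
    apply (is_RInt_gen_plus (fun u => (1 - l) / Gamma r * gamma_integrand r u)
      (fun u => l / Gamma t * gamma_integrand t u)).
    + apply (is_RInt_gen_scal (gamma_integrand r) ((1 - l) / Gamma r)), is_RInt_gen_Gamma, Hr.
    + apply (is_RInt_gen_scal (gamma_integrand t) (l / Gamma t)), is_RInt_gen_Gamma, Ht.
Qed.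

(** [x + e] and [y] are the convex combinations of [x] and [y + e] with complementary weights, so
    the two log-convexity bounds multiply to the right side. *)
Lemma Gamma_spread (x y e : R) : 0 < x < y -> 0 < e ->
  Gamma (x + e) * Gamma y <= Gamma x * Gamma (y + e).
Proof.
  intros Hxy He. set (l := e / (y + e - x)).
  assert (Hl : 0 <= l <= 1).
  { unfold l. split; [left; apply Rdiv_lt_0_compat; lra|].
    apply Rmult_le_reg_r with (y + e - x); [lra|].
    replace (e / (y + e - x) * (y + e - x)) with e by (field; lra). lra. }
  pose proof (Gamma_log_convex l x (y + e) Hl ltac:(lra) ltac:(lra)) as H1.
  pose proof (Gamma_log_convex (1 - l) x (y + e) ltac:(lra) ltac:(lra) ltac:(lra)) as H2.
  replace ((1 - l) * x + l * (y + e)) with (x + e) in H1 by (unfold l; field; lra).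
  replace ((1 - (1 - l)) * x + (1 - l) * (y + e)) with y in H2 by (unfold l; field; lra).
  pose proof (Gamma_pos x ltac:(lra)) as Gx. pose proof (Gamma_pos (y + e) ltac:(lra)) as Gt.
  eapply Rle_trans.
  { apply Rmult_le_compat; [left; apply Gamma_pos; lra|left; apply Gamma_pos; lra|exact H1|exact H2]. }
  rewrite <- exp_plus. right.
  replace ((1 - l) * ln (Gamma x) + l * ln (Gamma (y + e)) +
     ((1 - (1 - l)) * ln (Gamma x) + (1 - l) * ln (Gamma (y + e))))
    with (ln (Gamma x) + ln (Gamma (y + e))) by ring.
  rewrite exp_plus, !exp_ln by assumption. reflexivity.
Qed.

(** This is [Gamma_spread] at [x + j], [y + j], with the shifts by [j] turned into Pochhammer
    symbols. It supplies the [rho] of [hgseries_shift_scaled]. *)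
Lemma Gamma_ratio_poch (x y e : R) (j : nat) : 0 < x < y -> 0 < e ->
  Gamma (x + e) * Gamma y / (Gamma x * Gamma (y + e)) * (poch (x + e) j * poch y j)
  <= poch x j * poch (y + e) j.
Proof.
  intros Hxy He. pose proof (pos_INR j) as Hj.
  pose proof (Gamma_pos x ltac:(lra)) as Gx. pose proof (Gamma_pos (y + e) ltac:(lra)) as Gt.
  apply Rmult_le_reg_r with (Gamma x * Gamma (y + e)); [apply Rmult_lt_0_compat; assumption|].
  pose proof (Gamma_spread (x + INR j) (y + INR j) e ltac:(lra) He) as H.
  replace (x + INR j + e) with (x + e + INR j) in H by ring.
  replace (y + INR j + e) with (y + e + INR j) in H by ring.
  rewrite !Gamma_poch in H by lra.
  field_simplify; [|lra]. lra.
Qed.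

(** * Reduction to the case [b > c > 0], [0 < x < 1] *)

Lemma hgseries_ratio_bounds (a a' b c d x : R) :
  0 < a < a' -> 0 < c < b -> 0 < d -> 0 < x < 1 ->
  Gamma (a + d) * Gamma a' / (Gamma a * Gamma (a' + d))
  < hgseries (a' + d) b c x * hgseries a b c x / (hgseries (a + d) b c x * hgseries a' b c x)
  < 1.
Proof.
  intros Ha Hbc Hd Hx.
  assert (HD : 0 < hgseries (a + d) b c x * hgseries a' b c x)
    by (apply Rmult_lt_0_compat; apply hgseries_pos; lra).
  split.
  - apply Rmult_lt_reg_r with (1 := HD). unfold Rdiv at 2.
    rewrite Rmult_assoc, Rinv_l, Rmult_1_r by lra.
    apply hgseries_shift_scaled; try lra. intros j. apply Gamma_ratio_poch; assumption.
  - apply Rmult_lt_reg_r with (1 := HD). unfold Rdiv.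
    rewrite Rmult_assoc, Rinv_l, Rmult_1_r, Rmult_1_l by lra.
    apply hgseries_shift_lt; lra.
Qed.

(* The factor [K * exp (m * a)] is log-linear in [a]: it cancels from [ratio] and from the
   log-concavity inequality. *)
Lemma F21_reduce (b c x : R) : (0 < x < 1 /\ b > c /\ c > 0) \/ (x < 0 /\ c > 0 /\ 0 > b) ->
  exists B y K m, c < B /\ 0 < y < 1 /\ 0 < K /\ 0 < c /\
    forall a, F21 a b c x = K * exp (m * a) * hgseries a B c y.
Proof.
  unfold F21. intros [[Hx [Hb Hc]]|[Hx [Hc Hb]]].
  - exists b, x, 1, 0. repeat split; try lra. intros a.
    destruct (Rlt_dec x 0); [lra|]. rewrite Rmult_0_l, exp_0. ring.
  - set (y := x / (x - 1)).
    assert (Hy : 0 < y < 1).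
    { assert (E : y = - x / (1 - x)) by (unfold y; field; lra). rewrite E.
      split; [apply Rdiv_lt_0_compat; lra|].
      apply Rmult_lt_reg_r with (1 - x); [lra|]. unfold Rdiv.
      rewrite Rmult_assoc, Rinv_l by lra. lra. }
    (* Euler's transformation, applied after the Pfaff form in [F21], restores the parameter [a],
       turns [b] into [c - b > c], and costs [(1-y)^(a-b)]. *)
    exists (c - b), y, (Rpower (1 - x) (- b) * Rpower (1 - y) (- b)), (ln (1 - y)).
    repeat split; try lra.
    + apply Rmult_lt_0_compat; apply exp_pos.
    + intros a. destruct (Rlt_dec x 0); [|lra].
      rewrite (hgseries_euler (c - a) b c y) by assumption.
      replace (c - (c - a)) with a by ring. replace (a - b) with (- b + a) by ring.
      rewrite Rpower_plus. unfold Rpower at 3. rewrite (Rmult_comm a). ring.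
Qed.

(** Here [a] becomes [c - a], by Euler for [0 < x < 1] and directly by the Pfaff form for [x < 0].
    Upper bounds on [a] relative to [c] thus become lower bounds on the new parameter. *)
Lemma F21_reduce_reflected (b c x : R) :
  (0 < x < 1 /\ c > 0 /\ 0 > b) \/ (x < 0 /\ b > c /\ c > 0) ->
  exists B y K m, c < B /\ 0 < y < 1 /\ 0 < K /\ 0 < c /\
    forall a, F21 a b c x = K * exp (m * a) * hgseries (c - a) B c y.
Proof.
  unfold F21. intros [[Hx [Hc Hb]]|[Hx [Hb Hc]]].
  - exists (c - b), x, (Rpower (1 - x) (c - b)), (- ln (1 - x)).
    repeat split; try lra; [apply exp_pos|]. intros a.
    destruct (Rlt_dec x 0); [lra|].
    rewrite (hgseries_euler a b c x) by lra.
    replace (c - a - b) with ((c - b) + - a) by ring.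
    rewrite Rpower_plus. f_equal. f_equal. unfold Rpower. f_equal. ring.
  - exists b, (x / (x - 1)), (Rpower (1 - x) (- b)), 0.
    repeat split; try lra.
    + replace (x / (x - 1)) with (- x / (1 - x)) by (field; lra). apply Rdiv_lt_0_compat; lra.
    + replace (x / (x - 1)) with (- x / (1 - x)) by (field; lra).
      apply Rmult_lt_reg_r with (1 - x); [lra|]. unfold Rdiv.
      rewrite Rmult_assoc, Rinv_l by lra. lra.
    + apply exp_pos.
    + intros a. destruct (Rlt_dec x 0); [|lra]. rewrite Rmult_0_l, exp_0. ring.
Qed.

Lemma ratio_log_linear_factor (h : R -> R) (a a' b c d x K m : R) : 0 < K ->
  (forall z, F21 z b c x = K * exp (m * z) * h z) ->
  0 < h (a + d) -> 0 < h a' ->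
  ratio a a' b c d x = h (a' + d) * h a / (h (a + d) * h a').
Proof.
  intros HK HF H1 H2. unfold ratio. rewrite !HF, !Rmult_plus_distr_l, !exp_plus.
  pose proof (exp_pos (m * a)). pose proof (exp_pos (m * a')). pose proof (exp_pos (m * d)).
  field. repeat split; lra.
Qed.

Lemma log_concave_log_linear_factor (h : R -> R) (a b c d x K m : R) :
  (forall z, F21 z b c x = K * exp (m * z) * h z) ->
  h a * h (a + 2 * d) <= h (a + d) ^ 2 ->
  F21 (a + d) b c x ^ 2 >= F21 a b c x * F21 (a + 2 * d) b c x.
Proof.
  intros HF H. rewrite !HF. apply Rle_ge.
  replace (m * (a + 2 * d)) with (m * a + m * d + m * d) by ring.
  rewrite !Rmult_plus_distr_l, !exp_plus.
  replace (K * exp (m * a) * h a * (K * (exp (m * a) * exp (m * d) * exp (m * d)) * h (a + 2 * d)))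
    with ((K * (exp (m * a) * exp (m * d))) ^ 2 * (h a * h (a + 2 * d))) by ring.
  rewrite (Rpow_mult_distr _ (h (a + d))). apply Rmult_le_compat_l; [apply pow2_ge_0|exact H].
Qed.

Theorem theorem6 :
  (* (a) *)
  (forall a a' b c d : R,
     a' > a -> a >= 0 -> b > c -> c > 0 -> d > 0 ->
     diff_coef a a' b c d 0 = 0 /\ diff_coef a a' b c d 1 = 0 /\
     (forall k : nat, (2 <= k)%nat -> diff_coef a a' b c d k > 0))
  /\
  (* (b) log-concavity in a *)
  (forall a b c d x : R, d > 0 ->
     ( (0 <= a /\ ((0 < x < 1 /\ b > c /\ c > 0) \/ (x < 0 /\ c > 0 /\ 0 > b)))
       \/
       (a + 2 * d <= c /\ ((0 < x < 1 /\ c > 0 /\ 0 > b) \/ (x < 0 /\ b > c /\ c > 0))) ) ->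
     F21 (a + d) b c x ^ 2 >= F21 a b c x * F21 (a + 2 * d) b c x)
  /\
  (* (c) *)
  (forall a a' b c d x : R, d > 0 ->
     ((0 < x < 1 /\ b > c /\ c > 0) \/ (x < 0 /\ c > 0 /\ 0 > b)) ->
     a' > a -> a > 0 ->
     Gamma (a + d) * Gamma a' / (Gamma a * Gamma (a' + d)) < ratio a a' b c d x
     /\ ratio a a' b c d x < 1)
  /\
  (forall a a' b c d x : R, d > 0 ->
     ((0 < x < 1 /\ c > 0 /\ 0 > b) \/ (x < 0 /\ b > c /\ c > 0)) ->
     c - d > a' -> a' > a ->
     Gamma (c - a - d) * Gamma (c - a') / (Gamma (c - a) * Gamma (c - a' - d))
       < ratio a a' b c d x
     /\ ratio a a' b c d x < 1).
Proof.
  split; [|split; [|split]].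
  - intros a a' b c d Ha' Ha Hbc Hc Hd. split; [|split].
    + rewrite diff_coef_mult, hgcoef_mult_shift_eq; [ring|lra|lia].
    + rewrite diff_coef_mult, hgcoef_mult_shift_eq; [ring|lra|lia].
    + intros k Hk. rewrite diff_coef_mult.
      pose proof (hgcoef_mult_shift_lt a a' b c d k ltac:(lra) ltac:(lra) ltac:(lra) Hk). lra.
  - intros a b c d x Hd [[Ha Hr]|[Ha Hr]].
    + destruct (F21_reduce b c x Hr) as [B [y [K [m [HB [Hy [HK [Hc HF]]]]]]]].
      apply (log_concave_log_linear_factor _ a b c d x K m HF).
      (* Log-concavity is the case [a' = a + d]. *)
      pose proof (hgseries_shift_lt a (a + d) B c d y ltac:(lra) ltac:(lra) Hd Hy) as H.
      replace (a + d + d) with (a + 2 * d) in H by ring. lra.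
    + destruct (F21_reduce_reflected b c x Hr) as [B [y [K [m [HB [Hy [HK [Hc HF]]]]]]]].
      apply (log_concave_log_linear_factor (fun z => hgseries (c - z) B c y) a b c d x K m HF).
      pose proof (hgseries_shift_lt (c - (a + 2 * d)) (c - (a + d)) B c d y
        ltac:(lra) ltac:(lra) Hd Hy) as H.
      replace (c - (a + d) + d) with (c - a) in H by ring.
      replace (c - (a + 2 * d) + d) with (c - (a + d)) in H by ring. lra.
  - intros a a' b c d x Hd Hr Ha' Ha.
    destruct (F21_reduce b c x Hr) as [B [y [K [m [HB [Hy [HK [Hc HF]]]]]]]].
    rewrite (ratio_log_linear_factor (fun z => hgseries z B c y) a a' b c d x K m HK HF)
      by (apply hgseries_pos; lra).
    apply hgseries_ratio_bounds; lra.
  - intros a a' b c d x Hd Hr Ha' Ha.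
    destruct (F21_reduce_reflected b c x Hr) as [B [y [K [m [HB [Hy [HK [Hc HF]]]]]]]].
    rewrite (ratio_log_linear_factor (fun z => hgseries (c - z) B c y) a a' b c d x K m HK HF)
      by (apply hgseries_pos; lra).
    (* Reflection reverses the order, so the smallest parameter is now [c - a' - d > 0]. *)
    pose proof (hgseries_ratio_bounds (c - a' - d) (c - a - d) B c d y
      ltac:(lra) ltac:(lra) Hd Hy) as H.
    replace (c - a' - d + d) with (c - a') in H by ring.
    replace (c - a - d + d) with (c - a) in H by ring.
    replace (c - (a' + d)) with (c - a' - d) by ring.
    replace (c - (a + d)) with (c - a - d) by ring.
    rewrite (Rmult_comm (Gamma (c - a)) (Gamma (c - a' - d))),
      (Rmult_comm (Gamma (c - a - d)) (Gamma (c - a'))),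
      (Rmult_comm (hgseries (c - a' - d) B c y)), (Rmult_comm (hgseries (c - a - d) B c y)).
    exact H.
Qed.
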